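(* Let $\Bbbk$ be a field of characteristic zero, let $n,d\geq 1$ be integers, let $\ell_1,\ldots,\ell_{n+2}\in\Bbbk[x_1,\ldots,x_n]$ be general linear forms and let $R_{n,n+2,d}=\Bbbk[x_1,\ldots,x_n]/\langle \ell_1^d,\ldots,\ell_{n+2}^d\rangle$. Then the degree of the Hilbert series of $R_{n,n+2,d}$ equals $s(n,d)$, where $$s(n,d) = \begin{cases} \frac{(n+1)(d-1)}{2} & \text{if } n \text{ is odd,}\\[2pt] \left\lfloor \frac{n(n+2)(d-1)}{2(n+1)} \right\rfloor & \text{if } n \text{ is even.}\end{cases}$$
   Context: The Hilbert series of a standard graded $\Bbbk$-algebra $A=\bigoplus_{i\ge 0}A_i$ is $\sum_i (\dim_\Bbbk A_i) t^i$. For $A$ artinian and nonzero, the degree of its Hilbert series is $\max\{j : A_j\neq 0\}$. A statement about ''general linear forms'' $\ell_1,\ldots,\ell_m$ means that it holds for all tuples $(\ell_1,\ldots,\ell_m)$ in some nonempty Zariski-open subset of the space of $m$-tuples of linear forms in $\Bbbk[x_1,\ldots,x_n]$. *)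

(* Defs.v *)
From HB Require Import structures.
From mathcomp Require Import all_boot all_order all_algebra.
From mathcomp Require Export mpoly.

Set Implicit Arguments.
Unset Strict Implicit.
Unset Printing Implicit Defensive.

Import GRing.Theory.
Local Open Scope ring_scope.

Definition linear_form (k : fieldType) (n : nat) (a : 'rV[k]_n) : {mpoly k[n]} :=
  \sum_(j < n) a 0 j *: 'X_j.

Definition in_ideal (k : fieldType) (n m : nat) (g : 'I_m -> {mpoly k[n]})
    (f : {mpoly k[n]}) : Prop :=
  exists c : 'I_m -> {mpoly k[n]}, f = \sum_(i < m) c i * g i.

(* For subspaces U, W of V, the image of U in V / W has dimension r: there are
   b_0, ..., b_(r-1) in U whose classes form a basis of this image, that is,
   every u in U is congruent modulo W to a unique combination of the b_i. *)
Definition quotient_dim (k : fieldType) (V : lmodType k) (U W : V -> Prop)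
    (r : nat) : Prop :=
  exists2 b : 'I_r -> V, forall i, U (b i) &
    forall u, U u -> exists! c : 'rV[k]_r, W (u - \sum_(i < r) c 0 i *: b i).

(* h j is the coefficient of t^j in the Hilbert series of A = k[x] / (g), for
   homogeneous g; the graded piece A_j is the image in A of the homogeneous
   polynomials of degree j. *)
Definition is_hilbert_series (k : fieldType) (n m : nat)
    (g : 'I_m -> {mpoly k[n]}) (h : nat -> nat) : Prop :=
  forall j, quotient_dim (fun f : {mpoly k[n]} => f \is j.-homog) (in_ideal g)
              (h j).

Definition is_series_degree (h : nat -> nat) (s : nat) : Prop :=
  h s <> 0%N /\ forall j, h j <> 0%N -> (j <= s)%N.

(* Complements of common zero loci of arbitrary families F of polynomials. *)
Definition zariski_open (k : fieldType) (N : nat) (U : 'rV[k]_N -> Prop) : Prop :=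
  exists F : {mpoly k[N]} -> Prop,
    forall x, U x <-> exists2 p, F p & p.@[x 0] <> 0.

(* A tuple of m linear forms in n variables is given by the m x n matrix L of
   its coefficients; mxvec identifies these matrices with affine m*n-space. *)
Definition for_general_forms (k : fieldType) (m n : nat)
    (P : ('I_m -> {mpoly k[n]}) -> Prop) : Prop :=
  exists U : 'rV[k]_(m * n) -> Prop,
    [/\ zariski_open U, exists x, U x &
        forall L : 'M[k]_(m, n),
          U (mxvec L) -> P (fun i => linear_form (row i L))].

(* For odd n the division by 2 is exact. *)
Definition sdeg (n d : nat) : nat :=
  (if odd n then (n.+1 * (d - 1)) %/ 2
  else (n * n.+2 * (d - 1)) %/ (2 * n.+1))%N.

(* Main.v *)
From HB Require Import structures.
Require Import Defs.
From mathcomp Require Import all_boot all_order all_algebra.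
From mathcomp Require Import perm ring zify.
From Stdlib Require Import Classical.
Set Implicit Arguments.
Unset Strict Implicit.
Unset Printing Implicit Defensive.
Import GRing.Theory.
Local Open Scope ring_scope.

(* Write N = n + 2, delta = d - 1 and K = floor((n + 1) / 2); then s(n, d) is the
   floor of K N delta / (2 K + 1).  Vanishing of the degree j part of the quotient is
   an open condition, so the upper bound needs only one example: the points
   l_x = X_0 + x X_1 + ... + x^(n-1) X_(n-1) of the moment curve at N distinct
   parameters a_i.  Let phi be a nonzero linear form on the polynomials of degree j
   killing the ideal, and let q be maximal with phi(l_x^q w) <> 0 for some x, w.
   For suitable distinct y_1, ..., y_(j-q), the polynomial
   x |-> phi(l_x^q l_(y_1) ... l_(y_(j-q))) is nonzero of degree at most (n - 1) q,
   vanishes doubly at each y_b, by maximality of q, and to order q - delta at each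
   a_i; hence q + 2 j <= N delta.  Choosing in turn maximal exponents
   q = q_1 >= q_2 >= ... with phi(l_(x_1)^q_1 l_(x_2)^q_2 ...) <> 0, the r-th point
   gives a polynomial in x_r of degree at most (n - 1) q_r that vanishes to order
   2 q_r at the previous x_a; hence there are at most K points and j <= K q.

   For the lower bound, let the maximal minors of the N x n coefficient matrix L be
   nonzero.  Up to scaling the rows, the left kernel of L is spanned by (1, ..., 1) and
   (a_0, ..., a_(N-1)) with distinct a_i.  For a set S of 2 e + 1 indices, the
   determinant with rows (1, a_i, ..., a_i^e, z_i, z_i a_i, ..., z_i a_i^(e-1)), i in S,
   is of degree at most 1 in each z_i and invariant under the translations by the left
   kernel, so it descends to a form of degree e on k^n, of degree at most 1 along the
   row L_i for i in S and constant along the other rows.  A product of such forms of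
   total degree s(n, d), each i lying in at most delta of the sets, is annihilated by
   all d-th powers of the derivations along the L_i, i.e. by the ideal, in the apolar
   action. *)

(** * Polynomials over an infinite field *)

Lemma natr_inj_pchar0 (R : idomainType) :
  [pchar R] =i pred0 -> injective (fun i : nat => i%:R : R).
Proof.
move=> hR; have nz : forall m, (0 < m)%N -> (m%:R : R) != 0.
  move=> m m0; have := pcharf0P R; move=> [h _]; rewrite h //; by rewrite -lt0n.
have aux i j : (i <= j)%N -> (i%:R : R) = j%:R -> i = j.
  move=> le e; apply/eqP; rewrite eqn_leq le /= leqNgt; apply/negP=> lt.
  have := nz (j - i)%N; rewrite subn_gt0 lt => /(_ isT).
  by rewrite natrB // e subrr eqxx.
move=> i j /= e; case/orP: (leq_total i j) => le; first exact: aux.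
by apply/esym/aux.
Qed.

Section InfiniteField.
Variables (k : fieldType) (hk : [pchar k] =i pred0).

Lemma horner_eq0 (p : {poly k}) : (forall x, p.[x] = 0) -> p = 0.
Proof.
move=> h; apply/eqP/negPn/negP=> nz.
have := max_poly_roots nz (rs := [seq (i%:R : k) | i <- iota 0 (size p)]).
rewrite size_map size_iota ltnn => H; apply: notF; apply: H.
  by apply/allP=> x _; rewrite rootE h.
by rewrite map_inj_uniq ?iota_uniq //; apply: natr_inj_pchar0.
Qed.

Lemma horner_neq0_avoid (p : {poly k}) (s : seq k) :
  p != 0 -> exists2 x, x \notin s & p.[x] != 0.
Proof.
move=> nz; apply: NNPP => H; case/eqP: nz.
have nzs : \prod_(c <- s) ('X - c%:P) != 0 :> {poly k}.
  by apply/monic_neq0/monic_prod_XsubC.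
apply: (mulIf nzs); rewrite mul0r; apply: horner_eq0 => x.
rewrite hornerM; have [xs|xs] := boolP (x \in s).
  have /rootP -> : root (\prod_(c <- s) ('X - c%:P)) x by rewrite root_prod_XsubC.
  by rewrite mulr0.
have [->|nx] := eqVneq p.[x] 0; first by rewrite mul0r.
by case: H; exists x.
Qed.

(** Powers of distinct X - c are pairwise coprime, so their product divides p. This root count is
    behind the degree bounds for functionals. *)
Lemma sum_expn_dvdp (p : {poly k}) (s : seq k) (e : k -> nat) :
    p != 0 -> uniq s -> {in s, forall c, ('X - c%:P) ^+ e c %| p} ->
  (\sum_(c <- s) e c < size p)%N.
Proof.
move=> nz us h.
have szq (r : seq k) : size (\prod_(c <- r) ('X - c%:P) ^+ e c) = (\sum_(c <- r) e c).+1.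
  elim: r => [|c r IH]; first by rewrite !big_nil size_poly1.
  rewrite !big_cons size_monicM ?monic_exp ?monicXsubC //; last first.
    by rewrite -size_poly_eq0 IH.
  by rewrite IH size_exp_XsubC addSn addnS.
rewrite -szq; apply: dvdp_leq => //.
elim: s us h => [|c s IH] /=; first by rewrite big_nil dvd1p.
move=> /andP[cs us] h; rewrite big_cons Gauss_dvdp; last first.
  rewrite big_seq; apply: (big_ind (coprimep _)) => [|x y hx hy|i si].
  - exact: coprimep1.
  - by rewrite coprimepMr hx.
  - apply: coprimep_expl; apply: coprimep_expr.
    by rewrite coprimep_XsubC root_XsubC; apply: contra cs => /eqP<-.
rewrite h ?mem_head //=; apply: IH => // x xs; apply: h.
by rewrite inE xs orbT.
Qed.

End InfiniteField.

Lemma linear_form_homog (k : fieldType) (n : nat) (v : 'rV[k]_n) :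
  linear_form v \is 1.-homog.
Proof. by apply: rpred_sum => r _; apply: dhomogZ; rewrite dhomogX /= mdeg1. Qed.

(** * Upper bound on the moment curve *)

Section MomentCurve.
Variables (k : fieldType) (n : nat).
Local Notation R := {mpoly k[n]}.

Definition mform (x : k) : R := linear_form (\row_r x ^+ r).

(** The point of the moment curve at an indeterminate parameter: [map_poly phi (moment ^+ q * w%:P)]
    is the polynomial x |-> phi (l_x^q w) over k whose roots get counted. *)
Definition moment : {poly R} := \sum_(r < n) ('X_r : R)%:P * 'X^r.

Lemma horner_moment x : moment.[x%:MP] = mform x.
Proof.
rewrite /moment /mform horner_sum; apply: eq_bigr => r _.
by rewrite hornerM hornerC hornerXn mxE -(rmorphXn (@mpolyC n k)) mulrC mul_mpolyC.
Qed.

Lemma size_moment : (size moment <= n)%N.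
Proof.
apply: leq_trans (size_sum _ _ _) _; apply/bigmax_leqP => r _.
apply: leq_trans (size_polyMleq _ _) _.
rewrite size_polyXn addnS /= -[X in (_ <= X)%N](subnKC (ltn_ord r)).
have := size_polyC_leq1 ('X_r : R); case: (size _) => [|[]] //= _; last first.
  by rewrite add1n leq_addr.
by rewrite add0n addSn leqW // leq_addr.
Qed.

Section Functional.
Variable phi : {scalar R}.

Lemma horner_map_scalar (P : {poly R}) x :
  (map_poly phi P).[x] = phi P.[x%:MP].
Proof.
rewrite (@horner_coef_wide _ (size P)); last exact: size_poly.
rewrite horner_coef raddf_sum; apply: eq_bigr => i _.
by rewrite coef_map -(rmorphXn (@mpolyC n k)) mulrC -linearZ /= mulrC mul_mpolyC.
Qed.

(** As phi is k-linear, applying it to coefficients commutes with factors whose coefficients are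
    constants; divisibility over R thus passes to k. *)
Lemma map_scalar_XsubC x e (P : {poly R}) :
  map_poly phi (('X - (x%:MP)%:P) ^+ e * P) = ('X - x%:P) ^+ e * map_poly phi P.
Proof.
elim: e => [|e IH] in P *; first by rewrite !mul1r.
rewrite !exprSr -!mulrA IH; congr (_ * _).
rewrite !mulrBl raddfB /=; congr (_ - _); apply/polyP => i.
  by rewrite coef_map !coefXM; case: ifP => _; rewrite ?raddf0 ?coef_map.
by rewrite coef_map !coefCM coef_map mul_mpolyC; exact: linearZ.
Qed.

Lemma map_scalar_eq0 c (P : {poly R}) :
  (forall w, phi (c * w) = 0) -> map_poly phi (c%:P * P) = 0.
Proof. by move=> h; apply/polyP => i; rewrite coef_map coefCM coef0; exact: h. Qed.

Lemma deriv_map_scalar (P : {poly R}) :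
  (map_poly phi P)^`() = map_poly phi P^`().
Proof. by apply/polyP => i; rewrite coef_map !coef_deriv coef_map raddfMn. Qed.

End Functional.
End MomentCurve.

Lemma exists_max (P : nat -> Prop) i b :
    P i -> (forall j, P j -> (j <= b)%N) ->
  exists2 j, P j & forall j', P j' -> (j' <= j)%N.
Proof.
move=> Pi hb; have [c] := ubnP (b - i); elim: c => // c IH in i Pi *.
move=> /ltnSE lt; have [[j [Pj ij]]|none] := classic (exists j, P j /\ (i < j)%N).
  by apply: (IH j Pj); apply: leq_trans lt; apply: ltn_sub2l => //; apply: leq_trans (hb j Pj).
exists i => // j Pj; rewrite leqNgt; apply/negP => ij; apply: none.
by exists j.
Qed.

(** * Vanishing orders along the curve and the degree bound *)

Section HomogeneousFunctional.
Variables (k : fieldType) (n : nat) (hk : [pchar k] =i pred0).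
Local Notation R := {mpoly k[n]}.
Local Notation mform := (@mform k n).
Local Notation moment := (@moment k n).
Variable phi : {scalar R}.

Lemma mform_homog x : mform x \is 1.-homog.
Proof. exact: linear_form_homog. Qed.

Lemma moment_divX x :
  exists r, moment = (mform x)%:P + ('X - (x%:MP)%:P) * r.
Proof.
have /factor_theorem[r hr] : root (moment - (mform x)%:P) x%:MP.
  by rewrite rootE hornerD hornerN hornerC horner_moment subrr.
by exists r; rewrite mulrC -hr addrC subrK.
Qed.

Lemma moment_divX2 x :
  exists r, moment = (mform x)%:P + ('X - (x%:MP)%:P) * (moment^`().[x%:MP])%:P
                     + ('X - (x%:MP)%:P) ^+ 2 * r.
Proof.
have [r hr] := moment_divX x.
have dr : moment^`().[x%:MP] = r.[x%:MP].
  rewrite hr derivD derivC add0r derivM hornerD !hornerM derivXsubC !hornerC.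
  by rewrite hornerXsubC subrr mul0r addr0 mul1r.
have /factor_theorem[s hs] : root (r - (r.[x%:MP])%:P) x%:MP.
  by rewrite rootE hornerD hornerN hornerC subrr.
exists s; rewrite dr {1}hr -addrA; congr (_ + _).
rewrite expr2 -mulrA -mulrDr; congr (_ * _).
by rewrite [_ * s]mulrC -hs addrC subrK.
Qed.

Lemma scalar_mul_eq0 c : (forall m, phi (c * 'X_[m]) = 0) -> forall w, phi (c * w) = 0.
Proof.
move=> h w; rewrite [w]mpolyE mulr_sumr raddf_sum big1 // => m _.
transitivity (w@_m * phi (c * 'X_[m])); last by rewrite h mulr0.
by rewrite -scalerAr; apply: linearZ.
Qed.

(* Differentiating x |-> phi (u l_x^(p+1) w) replaces one factor l_x by its derivative. *)
Lemma kill_deriv u p :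
    (forall x w, phi (u * mform x ^+ p.+1 * w) = 0) ->
  forall x w, phi (u * mform x ^+ p * (moment^`().[x%:MP] * w)) = 0.
Proof.
move=> h x w.
have P0 : map_poly phi (moment ^+ p.+1 * (u * w)%:P) = 0.
  apply: horner_eq0 => // y; rewrite horner_map_scalar hornerM hornerC horner_exp.
  by rewrite horner_moment mulrCA mulrA h.
have := congr1 (fun P => P^`().[x]) P0.
rewrite deriv_map_scalar horner_map_scalar derivM derivC mulr0 addr0 deriv_exp.
rewrite deriv0 horner0 /= hornerM hornerC hornerMn hornerM horner_exp horner_moment.
rewrite mulrnAl raddfMn /= -mulr_natr => /eqP; rewrite mulf_eq0 orbC.
have -> /= : (p.+1%:R == 0 :> k) = false by rewrite (pcharf0P k).1.
move=> /eqP e; apply: etrans e; congr (phi _); ring.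
Qed.

(** Expand one factor [moment] at x to second order. The constant term is killed by the hypothesis
    and the linear term by [kill_deriv], so each of the q factors yields (X - x)^2. *)
Lemma diag_dvdp u p :
    (forall x w, phi (u * mform x ^+ p.+1 * w) = 0) ->
  forall x q w, ('X - x%:P) ^+ (2 * q) %|
    map_poly phi (moment ^+ q * (u * mform x ^+ p * w)%:P).
Proof.
move=> h x q w; rewrite [(_ * w)%:P]polyCM; move: (w%:P) => {w} W.
have h' := kill_deriv h; have [r hr] := moment_divX2 x.
elim: q W => [|q IH] W; first by rewrite muln0 dvd1p.
set c := u * _ in IH *; have -> : moment ^+ q.+1 * (c%:P * W) =
   c%:P * (mform x)%:P * (moment ^+ q * W)
   + c%:P * (moment^`().[x%:MP])%:P * (('X - (x%:MP)%:P) * (moment ^+ q * W))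
   + ('X - (x%:MP)%:P) ^+ 2 * (moment ^+ q * (c%:P * (r * W))).
  by rewrite exprS {1}hr; ring.
rewrite !raddfD /= -!polyCM map_scalar_eq0 ?add0r; last first.
  by move=> v; rewrite /c -(mulrA u) -exprSr h.
rewrite map_scalar_eq0 ?add0r; last by move=> v; rewrite -mulrA h'.
by rewrite map_scalar_XsubC mulnS exprD dvdp_mul2l ?IH // expf_neq0 // polyXsubC_eq0.
Qed.

Lemma pow_dvdp a e :
    (forall w, phi (mform a ^+ e.+1 * w) = 0) ->
  forall q w, ('X - a%:P) ^+ (q - e) %| map_poly phi (moment ^+ q * w%:P).
Proof.
move=> h q w; move: (w%:P) => {w} W; have [r hr] := moment_divX a.
(* The induction trades each factor [moment] for a factor l_a or a factor X - a. The exponent i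
   counts the factors l_a, and phi vanishes once i > e. *)
suff: ('X - a%:P) ^+ (q + 0 - e) %| map_poly phi (moment ^+ q * ((mform a ^+ 0)%:P * W)).
  by rewrite addn0 mul1r.
elim: q 0%N W => [|q IH] i W; have [ei|ie] := ltnP e i; try by
  rewrite mulrCA -(subnKC ei) exprD polyCM -!mulrA map_scalar_eq0 // dvdp0.
  by rewrite add0n (eqP ie) dvd1p.
have -> : moment ^+ q.+1 * ((mform a ^+ i)%:P * W) =
   moment ^+ q * ((mform a ^+ i.+1)%:P * W) +
   ('X - (a%:MP)%:P) ^+ 1 * (moment ^+ q * ((mform a ^+ i)%:P * (r * W))).
  by rewrite !exprS {1}hr polyCM; ring.
rewrite raddfD /= map_scalar_XsubC; apply: dvdp_add; last first.
  have le : (q.+1 + i - e <= 1 + (q + i - e))%N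
    by rewrite leq_subLR addnCA addSn ltnS -leq_subLR.
  apply: dvdp_trans (dvdp_exp2l _ le) _; rewrite exprD.
  by rewrite dvdp_mul2l ?IH // expf_neq0 // polyXsubC_eq0.
by rewrite addSnnS IH.
Qed.

Variable j : nat.
Hypothesis phi_homog : forall e f, f \is e.-homog -> e != j -> phi f = 0.

Lemma exists_monomial u e w : u \is e.-homog -> phi (u * w) <> 0 ->
  exists2 m : 'X_{1..n}, phi (u * 'X_[m]) <> 0 & (e + mdeg m)%N = j.
Proof.
move=> hu nz; apply: NNPP => none; apply: nz; apply: scalar_mul_eq0 => m.
apply: NNPP => nzm; apply: none; exists m => //; apply/eqP/negPn/negP => ne.
by apply: nzm; apply: phi_homog ne; rewrite dhomogM // dhomogX.
Qed.

(** Split a variable X_r off a monomial X_r w' with phi (u X_r w') nonzero: this value is the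
    coefficient of y^r in y |-> phi (u l_y w'), which is therefore nonzero at some y off s. *)
Lemma exists_mform u e w (s : seq k) : u \is e.-homog -> phi (u * w) <> 0 ->
    (e < j)%N ->
  exists2 y, y \notin s & exists w', phi (u * mform y * w') <> 0.
Proof.
move=> hu nz lt; have [m nzm em] := exists_monomial hu nz.
have [r r0] : exists r, (m r != 0)%N.
  apply/existsP; rewrite -negb_forall; apply: contraL lt => /forallP m0.
  rewrite -leqNgt -em mdegE big1 ?addn0 // => r _.
  by apply/eqP.
have em' : m = (U_(r) + (m - U_(r)))%MM by rewrite addmC submK // lep1mP.
set m' := (m - U_(r))%MM in em'.
have nzP : map_poly phi (moment * (u * 'X_[m'])%:P) != 0.
  apply: contra_not_neq nzm => /(congr1 (fun p : {poly k} => p`_r)).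
  rewrite coef0 coef_map coefMC /= coef_sum (bigD1 r) //= big1 ?addr0; last first.
    move=> i ir; rewrite coefCM coefXn; have -> : (r == i :> nat) = false.
      by apply/negbTE; rewrite eq_sym.
    by rewrite mulr0.
  by rewrite coefCM coefXn eqxx mulr1 em' mpolyXD mulrCA.
have [y ys] := horner_neq0_avoid hk s nzP.
rewrite horner_map_scalar hornerM hornerC horner_moment => nzy.
exists y => //; exists 'X_[m']; apply/eqP.
by rewrite -mulrA mulrCA.
Qed.

Lemma exists_mform_prod u e w (s : seq k) : u \is e.-homog -> phi (u * w) <> 0 ->
    uniq s ->
  exists ys, [/\ uniq (ys ++ s), (e + size ys)%N = j &
                 phi (u * \prod_(y <- ys) mform y) <> 0].
Proof.
have [c] := ubnP (j - e); elim: c => // c IH in u e w s *.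
move=> /ltnSE lt hu nz us; have [m nzm em] := exists_monomial hu nz.
have [ej|je] := ltnP e j; last first.
  have /eqP : mdeg m = 0%N by lia.
  rewrite mdeg_eq0 => /eqP m0; exists [::]; split=> //.
    by rewrite addn0; lia.
  by rewrite big_nil -mpolyX0 -m0.
have [y ys [w' nz']] := exists_mform s hu nz ej.
have hy := dhomogM hu (mform_homog y).
have [||ys' [us' sz nz'']] := IH _ _ _ (y :: s) _ hy nz'; first by lia.
  by rewrite /= ys.
exists (y :: ys'); split; last by rewrite big_cons mulrA.
  by move: us'; rewrite (uniq_catCA ys' [:: y]).
by rewrite /= -sz addn1 addSnnS.
Qed.

Lemma mform_exp_le u e q x w : u \is e.-homog ->
  phi (u * mform x ^+ q * w) <> 0 -> (e + q <= j)%N.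
Proof.
move=> hu nz; have := dhomogM hu (dhomogMn q (mform_homog x)).
by rewrite mul1n => /exists_monomial /(_ nz)[m _ <-]; rewrite leq_addr.
Qed.

Lemma size_moment_exp q w :
  (size (map_poly phi (moment ^+ q * w%:P)) <= (n.-1 * q).+1)%N.
Proof.
apply: leq_trans (size_poly _ _) _; apply: leq_trans (size_polyMleq _ _) _.
have h1 : (size (moment ^+ q) <= (n.-1 * q).+1)%N.
  apply: leq_trans (size_poly_exp_leq _ _) _; rewrite ltnS leq_mul2r.
  by have := size_moment k n; lia.
by have := leq_add h1 (size_polyC_leq1 w); rewrite addn1; case: (_ + _)%N.
Qed.

(* The points of s carry the factors of u; each of them costs 2q out of the degree
   (n-1)q of the polynomial y |-> phi (u l_y^q w), so that at most (n+1)/2 fit. *)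
Lemma degree_le_parts u e w (s : seq k) M : (0 < n)%N -> u \is e.-homog -> phi (u * w) <> 0 ->
    uniq s ->
    {in s, forall c q w', ('X - c%:P) ^+ (2 * q) %|
       map_poly phi (moment ^+ q * (u * w')%:P)} ->
    (forall q x w', phi (u * mform x ^+ q * w') <> 0 -> (q <= M)%N) ->
  (j - e <= (n.+1./2 - size s) * M)%N.
Proof.
move=> n0; have [c] := ubnP (j - e); elim: c => // c IH in u e w s *.
move=> /ltnSE lt hu nz us div leM.
have [ej|je] := ltnP e j; last by rewrite (eqP (je : (j - e == 0)%N)).
have [y _ [w1 nz1]] := exists_mform [::] hu nz ej.
have [||q [x0 [w2 nz2]] qmax] := @exists_max
    (fun q => exists x w', phi (u * mform x ^+ q * w') <> 0) 1 M.
- by exists y, w1; rewrite expr1.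
- by move=> q [x [w' /leM]].
have q0 : (0 < q)%N by apply: qmax; exists y, w1; rewrite expr1.
pose P := map_poly phi (moment ^+ q * (u * w2)%:P).
have nzP : P != 0.
  apply: contra_not_neq nz2 => /(congr1 (fun p : {poly k} => p.[x0])).
  rewrite horner0 horner_map_scalar hornerM hornerC horner_exp horner_moment => e0.
  by apply: etrans e0; congr (phi _); ring.
have szs : (2 * size s <= n.-1)%N.
  have := sum_expn_dvdp nzP us (fun c cs => div c cs q w2).
  rewrite big_const_seq count_predT iter_addn_0 => /leq_trans /(_ (size_moment_exp _ _)).
  by rewrite ltnS mulnAC leq_mul2r; lia.
(* The maximal exponent q is also attained at a point x off s. By maximality [diag_dvdp] applies to
   u l_x^q, so x can join s. *)
have [x xs] := horner_neq0_avoid hk s nzP.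
rewrite horner_map_scalar hornerM hornerC horner_exp horner_moment => nzx.
have hu' := dhomogM hu (dhomogMn q (mform_homog x)).
have vanish x' w' : phi (u * mform x' ^+ q.+1 * w') = 0.
  apply: NNPP => nz'; have := qmax q.+1; rewrite ltnn => H.
  by apply: notF; apply: H; exists x', w'.
have nz' : phi (u * mform x ^+ q * w2) <> 0.
  by move=> e0; case/eqP: nzx; apply: etrans e0; congr (phi _); ring.
have := mform_exp_le hu nz'.
have := IH _ _ w2 (x :: s) _ hu' nz'.
rewrite mul1n /= xs us => H le; have {H} := H _ isT.
have -> : (j - e = (j - (e + q)) + q)%N by lia.
have qM : (q <= M)%N by apply: leM nz2.
move=> H; apply: leq_trans (leq_add (H _ _ _) qM) _ => [|c1||].
- by lia.
- rewrite inE => /predU1P[->|cs] q' w'; first exact: diag_dvdp.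
  by rewrite -mulrA; apply: div.
- move=> q' x' w' nzq'; apply: (leM q' x' (mform x ^+ q * w')).
  by move=> e0; apply: nzq'; apply: etrans e0; congr (phi _); ring.
- rewrite -mulSnr leq_mul2r; apply/orP; right.
  by move: szs; rewrite uphalf_half; have := odd_double_half n; lia.
Qed.

Lemma double_root_dvdp (p : {poly k}) c :
  p.[c] = 0 -> p^`().[c] = 0 -> ('X - c%:P) ^+ 2 %| p.
Proof.
move=> /eqP; rewrite -rootE -dvdp_XsubCl => /dvdpP[r ->].
rewrite derivM hornerD !hornerM derivXsubC hornerXsubC subrr mulr0 add0r hornerC mulr1.
by move=> /eqP; rewrite -rootE -dvdp_XsubCl expr2 => h; rewrite dvdp_mul2r ?polyXsubC_eq0.
Qed.

(** At y the value is phi (l_y^(q+1) w), and the derivative is q times phi (l_y' l_y^q w), which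
    [kill_deriv] makes zero. *)
Lemma double_point_dvdp q :
    (forall x w, phi (mform x ^+ q.+1 * w) = 0) ->
  forall y w, ('X - y%:P) ^+ 2 %| map_poly phi (moment ^+ q * (mform y * w)%:P).
Proof.
move=> h y w; apply: double_root_dvdp.
  rewrite horner_map_scalar hornerM hornerC horner_exp horner_moment.
  by apply: etrans (h y w); congr (phi _); rewrite exprSr mulrA.
rewrite deriv_map_scalar horner_map_scalar derivM derivC mulr0 addr0 deriv_exp.
rewrite hornerM hornerC hornerMn hornerM horner_exp horner_moment mulrnAl raddfMn /=.
case: q h => [|q] h; first by rewrite mulr0n.
have h1 x w1 : phi (1 * mform x ^+ q.+2 * w1) = 0 by rewrite mul1r h.
have := kill_deriv h1 y w; set t := phi _ => t0.
suff -> : phi (moment^`().[y%:MP] * mform y ^+ q.+1.-1 * (mform y * w)) = t.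
  by rewrite t0 mul0rn.
by congr (phi _); rewrite /= exprS; ring.
Qed.

Lemma degree_bound (a : 'I_n.+2 -> k) (delta : nat) : (0 < n)%N -> injective a ->
    (forall i w, phi (mform (a i) ^+ delta.+1 * w) = 0) ->
    (exists w, phi w <> 0) ->
  ((n.+1./2).*2.+1 * j <= n.+1./2 * (n.+2 * delta))%N.
Proof.
move=> n0 inja kill [w0 nz0]; have [->|j0] := posnP j; first by rewrite muln0.
have hom1 : (1 : R) \is 0.-homog by apply: dhomog1.
have nz1 : phi (1 * w0) <> 0 by rewrite mul1r.
have [y _ [w1 nzy]] := exists_mform [::] hom1 nz1 j0.
have [||q [x [w2 nz2]] qmax] := @exists_max
    (fun q => exists x w', phi (mform x ^+ q * w') <> 0) 1 j.
- by exists y, w1; rewrite expr1 -[mform y]mul1r.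
- by move=> q [x [w nz]]; apply: (mform_exp_le hom1 (w := w) (x := x)); rewrite mul1r.
have jK : (j <= n.+1./2 * q)%N.
  have := degree_le_parts n0 hom1 nz1 (s := [::]) (M := q); rewrite /= !subn0; apply=> //.
  by move=> q' x' w'; rewrite mul1r => nz; apply: qmax; exists x', w'.
have vanish x' w' : phi (mform x' ^+ q.+1 * w') = 0.
  apply: NNPP => nz'; have := qmax q.+1; rewrite ltnn => H.
  by apply: notF; apply: H; exists x', w'.
have homq := dhomogMn q (mform_homog x); rewrite mul1n in homq.
have ua : uniq (codom a) by rewrite map_inj_uniq ?enum_uniq.
(* The ys avoid the parameters a_i, so the double roots at the ys and the roots at the a_i add
   up. *)
have [ys [us szys nzP]] := exists_mform_prod homq nz2 ua.
pose P := map_poly phi (moment ^+ q * (\prod_(y <- ys) mform y)%:P).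
have {nzP} nzP : P != 0.
  apply: contra_not_neq nzP => /(congr1 (fun p : {poly k} => p.[x])).
  by rewrite horner0 horner_map_scalar hornerM hornerC horner_exp horner_moment.
have := @sum_expn_dvdp _ P _ (fun c => if c \in ys then 2 else q - delta)%N nzP us.
have -> : (\sum_(c <- ys ++ codom a) (if c \in ys then 2 else q - delta) =
           2 * size ys + (q - delta) * n.+2)%N.
  rewrite big_cat /=; congr (_ + _)%N.
    rewrite big_seq (eq_bigr (fun=> 2)) => [|c ->] //.
    by rewrite -big_seq big_const_seq count_predT iter_addn_0.
  rewrite big_seq (eq_bigr (fun=> q - delta)%N) => [|c ca].
    by rewrite -big_seq big_const_seq count_predT iter_addn_0 size_codom card_ord.
  case: ifP => // cy; move: us; rewrite cat_uniq => /and3P[_ /hasPn /(_ c ca)].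
  by rewrite /= cy.
move=> H; have {H} := leq_trans (H _) (size_moment_exp _ _).
rewrite ltnS => H; have {H} : (2 * size ys + (q - delta) * n.+2 <= n.-1 * q)%N.
  apply: H => c; rewrite mem_cat; case: ifP => [cy _|_ /= /codomP[i ->]].
    by rewrite /P (perm_big _ (perm_to_rem cy)) big_cons; apply: double_point_dvdp.
  exact: pow_dvdp.
(* As [size ys] is j - q, the count gives 2j + q <= (n+2) delta, also when q < delta truncates the
   subtraction. Multiplying by K and using j <= K q gives the bound. *)
move=> H; have {}H : (j.*2 + q <= n.+2 * delta)%N by nia.
by nia.
Qed.
End HomogeneousFunctional.

(** * Graded pieces of the quotient as cokernels of matrices *)

Section Macaulay.
Variables (n m d j : nat).

(* The cofactors u that bring forms of degree e to degree j; there are none if e > j. *)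
Definition hmon (e : nat) := {u : 'X_{1..n < j.+1} | (mdeg u + e == j)%N}.

Definition mon_of (e : nat) (u : hmon e) : 'X_{1..n} := bmnm (val u).

Lemma mdeg_mon_of e (u : hmon e) : (mdeg (mon_of u) + e)%N = j.
Proof. exact/eqP/(valP u). Qed.

Lemma mon_of_onto e (u : 'X_{1..n}) : (mdeg u + e)%N = j -> exists v : hmon e, mon_of v = u.
Proof.
move=> eu; have lt : (mdeg u < j.+1)%N by rewrite ltnS -eu leq_addr.
have h : (mdeg (BMultinom lt) + e == j)%N by apply/eqP.
by exists (Sub (BMultinom lt) h); rewrite /mon_of SubK.
Qed.

Lemma mon_of_inj e : injective (@mon_of e).
Proof. by move=> u v /val_inj/val_inj. Qed.

Definition col_mon (c : 'I_#|{: hmon 0}|) := mon_of (enum_val c).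

Lemma mdeg_col_mon c : mdeg (col_mon c) = j.
Proof. by rewrite -[RHS](mdeg_mon_of (enum_val c)) addn0. Qed.

Lemma col_mon_onto u : mdeg u = j -> exists c, col_mon c = u.
Proof.
move=> eu; have [|v <-] := @mon_of_onto 0 u; first by rewrite addn0.
by exists (enum_rank v); rewrite /col_mon enum_rankK.
Qed.

Lemma col_mon_inj : injective col_mon.
Proof. by move=> c c' /mon_of_inj /enum_val_inj. Qed.

(** For forms [g i] of degree d over a field, the row space is the degree j part of the ideal in
    monomial coordinates. The ring is arbitrary so that the coefficients of the forms may be
    indeterminates. *)
Definition macaulay (A : comNzRingType) (g : 'I_m -> {mpoly A[n]}) :
    'M[A]_(#|{: 'I_m * hmon d}|, #|{: hmon 0}|) :=
  \matrix_(r, c) ('X_[mon_of (enum_val r).2] * g (enum_val r).1)@_(col_mon c).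

Lemma map_macaulay (A B : comNzRingType) (f : {rmorphism A -> B}) g :
  map_mx f (macaulay g) = macaulay (fun i => map_mpoly f (g i)).
Proof.
apply/matrixP => r c; rewrite !mxE -mcoeff_map_mpoly rmorphM /=.
by rewrite map_mpolyX.
Qed.

Section Field.
Variables (k : fieldType) (g : 'I_m -> {mpoly k[n]}).
Hypothesis g_homog : forall i, g i \is d.-homog.
Local Notation R := {mpoly k[n]}.

Definition coords (f : R) : 'rV[k]_#|{: hmon 0}| := \row_c f@_(col_mon c).
Definition of_coords (v : 'rV[k]_#|{: hmon 0}|) : R := \sum_c v 0 c *: 'X_[col_mon c].

Lemma coords_is_linear : linear coords.
Proof. by move=> a u v; apply/rowP => c; rewrite !mxE mcoeffD mcoeffZ. Qed.
HB.instance Definition _ := GRing.isLinear.Build k R 'rV[k]_#|{: hmon 0}| _ coords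
  coords_is_linear.

Lemma of_coords_homog v : of_coords v \is j.-homog.
Proof. by apply: rpred_sum => c _; apply: dhomogZ; rewrite dhomogX /= mdeg_col_mon. Qed.

Lemma of_coordsK : cancel of_coords coords.
Proof.
move=> v; apply/rowP => c; rewrite mxE raddf_sum (bigD1 c) //= big1 ?addr0.
  by rewrite mcoeffZ mcoeffX eqxx mulr1.
move=> c' ne; rewrite mcoeffZ mcoeffX (inj_eq col_mon_inj) (negPf ne).
by rewrite mulr0.
Qed.

Lemma coords_homog_inj f f' : f \is j.-homog -> f' \is j.-homog ->
  coords f = coords f' -> f = f'.
Proof.
move=> hf hf' e; apply/mpolyP => u; have [/col_mon_onto[c <-]|ne] := eqVneq (mdeg u) j.
  by have := congr1 (fun v : 'rV_ _ => v 0 c) e; rewrite !mxE.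
by rewrite (dhomog_nemf_coeff hf ne) (dhomog_nemf_coeff hf' ne).
Qed.

Lemma coordsK f : f \is j.-homog -> of_coords (coords f) = f.
Proof.
by move=> hf; apply: coords_homog_inj; rewrite ?of_coords_homog ?of_coordsK.
Qed.

(** Vectors w with [macaulay g *m w = 0] give, through this pairing, the functionals in degree j
    that kill the ideal. *)
Definition col_form (w : 'cV[k]_#|{: hmon 0}|) (f : R) : k := (coords f *m w) 0 0.

Lemma col_form_is_scalar w : scalar (col_form w).
Proof. by move=> a u v; rewrite /col_form linearP mulmxDl -scalemxAl !mxE. Qed.
HB.instance Definition _ w := GRing.isLinear.Build k R k _ (col_form w)
  (col_form_is_scalar w).

Lemma col_form_homog w e f : f \is e.-homog -> e != j -> col_form w f = 0.
Proof.
move=> hf ne; rewrite /col_form mxE big1 // => c _; rewrite mxE.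
by rewrite (dhomog_nemf_coeff hf) ?mul0r //= mdeg_col_mon eq_sym.
Qed.

Lemma col_form_ideal w i f : macaulay g *m w = 0 -> col_form w (f * g i) = 0.
Proof.
move=> Mw; rewrite [f]mpolyE mulr_suml raddf_sum big1 // => u _ /=.
rewrite -scalerAl; transitivity (f@_u * col_form w ('X_[u] * g i)); first exact: linearZ.
have [/mon_of_onto[v <-]|ne] := eqVneq (mdeg u + d)%N j; last first.
  by rewrite (col_form_homog _ _ ne) ?mulr0 // dhomogM // dhomogX.
have := congr1 (fun M : 'cV_ _ => M (enum_rank (i, v)) 0) Mw; rewrite !mxE => {}Mw.
rewrite /col_form !mxE -[X in _ * X = _]/(\sum_c _) -[RHS](mulr0 (f@_(mon_of v))) -{2}Mw.
by congr (_ * _); apply: eq_bigr => c _; rewrite !mxE enum_rankK.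
Qed.

(** The cofactors c need not be homogeneous. Instead of extracting components, f is tested against
    the columns of [cokermx], whose functionals vanish on the whole ideal. *)
Lemma in_idealP f : f \is j.-homog ->
  in_ideal g f <-> (coords f <= macaulay g)%MS.
Proof.
move=> hf; split=> [[c ->]|/submxP[D eD]].
  rewrite submxE; apply/eqP/rowP => s.
  have Mw : macaulay g *m col s (cokermx (macaulay g)) = 0.
    by rewrite colE mulmxA mulmx_coker mul0mx.
  transitivity (col_form (col s (cokermx (macaulay g))) (\sum_i c i * g i)).
    by rewrite /col_form colE mulmxA -colE [RHS]mxE.
  by rewrite [RHS]mxE raddf_sum big1 // => i _; exact: col_form_ideal.
pose c i := \sum_(r | (enum_val r).1 == i) D 0 r *: 'X_[mon_of (enum_val r).2] : R.
exists c; rewrite -[LHS]coordsK //; apply: coords_homog_inj; first exact: of_coords_homog.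
  apply: rpred_sum => i _; rewrite mulr_suml; apply: rpred_sum => r _.
  rewrite -scalerAl; apply: dhomogZ; move: (enum_val r).2 => v.
  by rewrite -[X in X.-homog](mdeg_mon_of v) dhomogM // dhomogX.
rewrite of_coordsK eD; transitivity (\sum_r D 0 r *: row r (macaulay g)).
  by rewrite -mulmx_sum_row.
rewrite linear_sum (partition_big (fun r => (enum_val r).1) predT) //=.
apply: eq_bigr => i _; rewrite mulr_suml linear_sum /=; apply: eq_bigr => r /eqP <-.
by rewrite -scalerAl linearZ; congr (_ *: _); apply/rowP => s; rewrite !mxE.
Qed.

(** A basis of a complement of the row space represents a basis of the quotient. *)
Lemma quotient_dim_macaulay :
  quotient_dim (fun f : R => f \is j.-homog) (in_ideal g)
    (#|{: hmon 0}| - \rank (macaulay g)).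
Proof.
set M := macaulay g; have rkC : \rank (M^C)%MS = (#|{: hmon 0}| - \rank M)%N.
  by rewrite mxrank_compl.
move: (row_base _) (eq_row_base (M^C)%MS); rewrite rkC => B eB.
exists (fun i => of_coords (row i B)) => [i|f hf]; first exact: of_coords_homog.
have memE (c : 'rV[k]_(#|{: hmon 0}| - \rank M)) :
    in_ideal g (f - \sum_i c 0 i *: of_coords (row i B)) <->
    (coords f - c *m B <= M)%MS.
  rewrite in_idealP; last first.
    rewrite rpredB // rpred_sum // => i _; apply: dhomogZ; exact: of_coords_homog.
  rewrite linearB linear_sum /= (_ : \sum_i _ = c *m B) // mulmx_sum_row.
  by apply: eq_bigr => i _; rewrite linearZ /= of_coordsK.
have : (coords f <= M + B)%MS.
  apply: submx_full; rewrite /row_full (adds_eqmx (eqmx_refl M) eB).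
  exact: addsmx_compl_full.
case/sub_addsmxP=> [[x y] /= e]; exists y; split.
  by apply/memE; rewrite e addrK submxMl.
move=> y' /memE h; have freeB : row_free B by rewrite -row_leq_rank eB rkC.
apply: (row_free_inj freeB); apply/eqP; rewrite -subr_eq0 -mulmxBl -submx0.
rewrite -(capmx_compl M) sub_capmx -eB submxMl andbT.
have -> : (y - y') *m B = (coords f - y' *m B) - x *m M.
  by rewrite e mulmxBl [x *m M + _]addrC -addrA -addrA [- _ - _]addrC addrA addrA addrK.
by rewrite addmx_sub // eqmx_opp submxMl.
Qed.

Lemma macaulay_fullP :
  reflect (forall f : R, f \is j.-homog -> in_ideal g f) (row_full (macaulay g)).
Proof.
apply: (iffP idP) => [full f hf|h].
  by apply/in_idealP => //; apply: submx_full.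
rewrite -sub1mx; apply/row_subP => c; rewrite -[row c _]of_coordsK.
by apply/in_idealP; [|apply: h]; apply: of_coords_homog.
Qed.

End Field.
End Macaulay.

(** * Full rank and nonzero minors as open conditions *)

Section GenericForms.
Variables (k : fieldType) (m n : nat).

Definition generic_form (i : 'I_m) : {mpoly {mpoly k[m * n]}[n]} :=
  \sum_(j < n) ('X_(mxvec_index i j) : {mpoly k[m * n]}) *: 'X_j.

Lemma eval_generic_form (L : 'M[k]_(m, n)) i :
  map_mpoly (meval (mxvec L 0)) (generic_form i) = linear_form (row i L).
Proof.
rewrite raddf_sum; apply: eq_bigr => j _.
by rewrite /= map_mpolyZ map_mpolyX /= mevalXU mxvecE mxE.
Qed.

(** Full rank at [L0] shows in a nonzero maximal minor. That minor is a polynomial in the entries of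
    L, and wherever it is nonzero the rank is full. *)
Lemma macaulay_full_open d j (L0 : 'M[k]_(m, n)) :
    row_full (macaulay d j (fun i => linear_form (row i L0) ^+ d)) ->
  exists2 q : {mpoly k[m * n]}, q.@[mxvec L0 0] != 0 &
    forall L : 'M[k]_(m, n), q.@[mxvec L 0] != 0 ->
      row_full (macaulay d j (fun i => linear_form (row i L) ^+ d)).
Proof.
move=> full; pose f := fullrankfun full.
pose M := macaulay d j (fun i => generic_form i ^+ d).
have evM L : map_mx (meval (mxvec L 0)) M =
             macaulay d j (fun i => linear_form (row i L) ^+ d).
  rewrite map_macaulay; apply/matrixP => r c; rewrite !mxE.
  by rewrite rmorphXn /= eval_generic_form.
have evdet L : (\det (rowsub f M)).@[mxvec L 0] =
    \det (rowsub f (macaulay d j (fun i => linear_form (row i L) ^+ d))).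
  by rewrite -det_map_mx map_mxsub evM.
exists (\det (rowsub f M)) => [|L]; rewrite evdet.
  by rewrite -unitfE -unitmxE; apply: fullrowsub_unit.
rewrite -unitfE -unitmxE -row_full_unit -!col_leq_rank => /leq_trans; apply.
exact/mxrankS/rowsub_sub.
Qed.

Definition maximal_minors : {mpoly k[m * n]} :=
  \prod_(f : {ffun 'I_n -> 'I_m} | injectiveb f)
     \det (\matrix_(i, j) 'X_(mxvec_index (f i) j)).

Lemma maximal_minorsP (L : 'M[k]_(m, n)) :
  reflect (forall f : 'I_n -> 'I_m, injective f -> rowsub f L \in unitmx)
          (maximal_minors.@[mxvec L 0] != 0).
Proof.
have evdet f : (\det (\matrix_(i, j) 'X_(mxvec_index (f i) j))).@[mxvec L 0] =
    \det (rowsub f L).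
  rewrite -det_map_mx; congr (\det _); apply/matrixP => i j.
  by rewrite !mxE /= mevalXU mxvecE.
rewrite rmorph_prod /=; apply: (iffP (prodf_neq0 _ _)) => h f injf.
  have : injectiveb (finfun f) by apply/injectiveP => x y; rewrite !ffunE => /injf.
  move/h; rewrite evdet -unitfE -unitmxE.
  have -> // : rowsub (finfun f) L = rowsub f L.
  by apply/matrixP => i j; rewrite !mxE ffunE.
by rewrite evdet -unitfE -unitmxE h //; apply/injectiveP.
Qed.
End GenericForms.

(** * Lower bound by apolarity *)

Section Pade.
Variable e : nat.

(* A kernel vector is a pair (p, q) of polynomials of degrees at most e and e - 1 with
   p (a t) + z t * q (a t) = 0 for all t. *)
Definition pade (A : comNzRingType) (a z : 'I_(e.+1 + e) -> A) : 'M[A]_(e.+1 + e) :=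
  row_mx (\matrix_(t < e.+1 + e, c < e.+1) a t ^+ c)
         (\matrix_(t < e.+1 + e, c < e) (z t * a t ^+ c)).

Lemma map_pade (A B : comNzRingType) (f : {rmorphism A -> B}) a z :
  map_mx f (pade a z) = pade (f \o a) (f \o z).
Proof.
rewrite map_row_mx; congr row_mx; apply/matrixP => t c; rewrite !mxE.
  by rewrite rmorphXn.
by rewrite rmorphM rmorphXn.
Qed.

Lemma eq_pade (A : comNzRingType) (a a' z z' : 'I_(e.+1 + e) -> A) :
  a =1 a' -> z =1 z' -> pade a z = pade a' z'.
Proof.
move=> ea ez; congr row_mx; apply/matrixP => t c; rewrite !mxE ?ea //.
by rewrite ez.
Qed.

(** A column operation: column z a^c gains s a^c + r a^(c+1), and c < e puts both powers among the
    first e + 1 columns. *)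
Lemma det_pade_shift (A : comNzRingType) (a z : 'I_(e.+1 + e) -> A) (s r : A) :
  \det (pade a (fun t => z t + (s + r * a t))) = \det (pade a z).
Proof.
pose B : 'M[A]_(e.+1, e) :=
  \matrix_(i, c) (s * (i == c :> nat)%:R + r * (i == c.+1 :> nat)%:R).
suff -> : pade a (fun t => z t + (s + r * a t)) = pade a z *m block_mx 1%:M B 0 1%:M.
  by rewrite det_mulmx det_ublock !det1 !mulr1.
rewrite mul_row_block !mulmx1 mulmx0 addr0; congr row_mx.
apply/matrixP => t c; rewrite !mxE.
have c0 : (c < e.+1)%N by rewrite ltnS ltnW.
have c1 : (c.+1 < e.+1)%N by rewrite ltnS.
under eq_bigr => i _ do rewrite !mxE mulrDr.
rewrite big_split /= (bigD1 (Ordinal c0)) //= eqxx big1 => [|i ne]; last first.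
  by rewrite [_ == _](negPf ne) !mulr0.
rewrite [X in _ + X + _](bigD1 (Ordinal c1)) //= eqxx big1 => [|i ne]; last first.
  by rewrite [_ == _](negPf ne) !mulr0.
by rewrite exprS (_ : true%:R = 1) //; ring.
Qed.

(** For z = a^(e+1) the columns are the powers a^0, ..., a^(2e), a Vandermonde matrix. *)
Lemma det_pade_neq0 (k : fieldType) (a : 'I_(e.+1 + e) -> k) :
  injective a -> \det (pade a (fun t => a t ^+ e.+1)) != 0.
Proof.
move=> inja.
have -> : pade a (fun t => a t ^+ e.+1) = (Vandermonde (e.+1 + e) (\row_t a t))^T.
  apply/matrixP => t c; rewrite !mxE; case: splitP => c' ->; rewrite !mxE //.
  by rewrite exprD.
rewrite det_tr det_Vandermonde; apply/prodf_neq0 => i _; apply/prodf_neq0 => j ij.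
by rewrite !mxE subr_eq0; apply: contraTneq ij => /inja ->; rewrite ltnn.
Qed.

End Pade.

Lemma size_prod_le (A : comNzRingType) (I : Type) (r : seq I) (F : I -> {poly A}) b :
  (forall i, size (F i) <= (b i).+1)%N ->
  (size (\prod_(i <- r) F i)%R <= (\sum_(i <- r) b i).+1)%N.
Proof.
move=> h; elim: r => [|i r IH]; first by rewrite !big_nil size_poly1.
rewrite !big_cons; apply: leq_trans (size_polyMleq _ _) _.
by have := leq_add (h i) IH; rewrite addSn addnS; case: (_ + _)%N.
Qed.

Lemma size_det_rows (A : comNzRingType) m (M : 'M[{poly A}]_m) b :
  (forall i j, size (M i j) <= (b i).+1)%N ->
  (size (\det M) <= (\sum_i b i).+1)%N.
Proof.
move=> h; apply: leq_trans (size_sum _ _ _) _; apply/bigmax_leqP => s _.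
by rewrite mulr_sign; case: ifP => _; rewrite ?size_polyN; apply: size_prod_le => i.
Qed.

Lemma det_homog_cols (A : comNzRingType) n m (M : 'M[{mpoly A[n]}]_m) b :
  (forall i j, M i j \is (b j).-homog) -> \det M \is (\sum_j b j)%N.-homog.
Proof.
move=> h; apply: rpred_sum => /= s _.
have : \prod_i M i (s i) \is (\sum_i b (s i))%N.-homog.
  elim/big_ind2: _ => [|p x q y hp hq|i _]; [exact: dhomog1 | exact: dhomogM |].
  exact: h.
have -> : (\sum_i b (s i) = \sum_j b j)%N by rewrite [RHS](reindex_perm s).
rewrite mulr_sign => hp.
by case: ifP => _; rewrite ?rpredN.
Qed.

(** * Taylor shifts and directional derivatives *)

Section Shift.
Variables (k : fieldType) (n : nat).
Local Notation R := {mpoly k[n]}.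
Variable u : 'rV[k]_n.

(* G(x) |-> G(x + t u), where t is the variable of {poly R}. *)
Definition shift : R -> {poly R} := locked
  (mmap (polyC \o @mpolyC n k) (fun r => ('X_r)%:P + ((u 0 r)%:MP)%:P * 'X)).

Lemma shift_is_zmod_morphism : zmod_morphism shift.
Proof. by move=> p q; rewrite /shift -lock rmorphB. Qed.

Lemma shift_is_monoid_morphism : monoid_morphism shift.
Proof. by rewrite /shift -lock; split=> [|p q]; rewrite ?rmorph1 ?rmorphM. Qed.

HB.instance Definition _ := GRing.isZmodMorphism.Build R {poly R} shift
  shift_is_zmod_morphism.
HB.instance Definition _ := GRing.isMonoidMorphism.Build R {poly R} shift
  shift_is_monoid_morphism.

Lemma shiftC c : shift c%:MP = (c%:MP)%:P.
Proof. by rewrite /shift -lock; apply: mmapC. Qed.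

Lemma shiftX r : shift 'X_r = ('X_r)%:P + ((u 0 r)%:MP)%:P * 'X.
Proof. by rewrite /shift -lock mmapX mmap1U. Qed.

Lemma shiftZ c p : shift (c *: p) = (c%:MP)%:P * shift p.
Proof. by rewrite -mul_mpolyC rmorphM /= shiftC. Qed.

Lemma shift_linear_form v :
  shift (linear_form v) = (linear_form v)%:P + ((\sum_r u 0 r * v 0 r)%:MP)%:P * 'X.
Proof.
rewrite /linear_form !rmorph_sum /= mulr_suml -big_split; apply: eq_bigr => r _ /=.
by rewrite shiftZ shiftX -mul_mpolyC !rmorphM /=; ring.
Qed.

Definition dirderiv (G : R) : R := \sum_r u 0 r *: G^`M(r).

Lemma dirderiv_is_linear : linear dirderiv.
Proof.
move=> c p q; rewrite /dirderiv scaler_sumr -big_split; apply: eq_bigr => r _ /=.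
by rewrite mderivD mderivZ scalerDr !scalerA mulrC.
Qed.
HB.instance Definition _ := GRing.isLinear.Build k R R _ dirderiv dirderiv_is_linear.

Lemma dirderivM p q : dirderiv (p * q) = dirderiv p * q + p * dirderiv q.
Proof.
rewrite /dirderiv mulr_suml mulr_sumr -big_split; apply: eq_bigr => r _ /=.
by rewrite mderivM scalerDr scalerAl scalerAr.
Qed.

Lemma deriv_shift G : (shift G)^`() = shift (dirderiv G).
Proof.
have homM p q : (shift p)^`() = shift (dirderiv p) -> (shift q)^`() = shift (dirderiv q) ->
    (shift (p * q))^`() = shift (dirderiv (p * q)).
  by move=> hp hq; rewrite dirderivM rmorphD !rmorphM derivM hp hq.
have homX r : (shift 'X_r)^`() = shift (dirderiv 'X_r).
  rewrite shiftX derivD derivC add0r derivM derivC mul0r add0r derivX mulr1.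
  rewrite /dirderiv (bigD1 r) //= big1 ?addr0 => [|i ne].
    have -> : ('X_r)^`M(r) = 1%:MP :> R.
      rewrite mderivX mnmE eqxx scale1r mpolyC1 -mpolyX0; congr 'X_[_].
      by apply/mnmP => i; rewrite mnmBE mnm0E subnn.
    by rewrite -mul_mpolyC mulr1 shiftC.
  by rewrite mderivX mnmE eq_sym (negPf ne) scale0r scaler0.
have hom1 : (shift 1)^`() = shift (dirderiv 1).
  rewrite rmorph1 derivC /dirderiv big1 ?rmorph0 // => r _.
  by rewrite -mpolyC1 mderivC scaler0.
elim/mpolyind: G => [|c m p _ _ IH]; first by rewrite linear0 rmorph0 derivC.
rewrite linearP rmorphD derivD IH [in RHS]rmorphD /= !shiftZ derivM derivC mul0r add0r.
congr (_ * _ + _); rewrite mpolyXE_id; elim/big_ind: _ => // r _.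
by elim: (m r) => [|q IHq]; rewrite ?expr0 // exprS homM.
Qed.

Lemma horner0_shift G : (shift G).[0] = G.
Proof.
rewrite [in LHS](mpolyE G) [in RHS](mpolyE G) !rmorph_sum horner_sum /=.
apply: eq_bigr => m _; rewrite shiftZ hornerM hornerC mul_mpolyC; congr (_ *: _).
rewrite mpolyXE_id rmorph_prod horner_prod; apply: eq_bigr => r _.
by rewrite rmorphXn horner_exp /= shiftX !hornerE.
Qed.

(** The d-th directional derivative of G is the d-th derivative of G(x + t u) in t at t = 0. A bound
    on the degree along u thus becomes annihilation. *)
Lemma iter_dirderiv_eq0 d G : (size (shift G) <= d)%N -> iter d dirderiv G = 0.
Proof.
move=> sz; rewrite -[LHS]horner0_shift.
have -> : shift (iter d dirderiv G) = (shift G)^`(d).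
  by elim: (d) => [|q IH] /=; rewrite ?derivn0 // -deriv_shift IH.
by rewrite derivn_poly0 // horner0.
Qed.
End Shift.

(** * The apolar pairing *)

Section Apolarity.
Variables (k : fieldType) (hk : [pchar k] =i pred0) (n m d j : nat).
Local Notation R := {mpoly k[n]}.

Lemma mderivm_dirderiv u q (G : R) h :
  (iter q (dirderiv u) G)^`M[h] = iter q (dirderiv u) G^`M[h].
Proof.
elim: q => //= q <-; rewrite /dirderiv raddf_sum; apply: eq_bigr => r _ /=.
by rewrite mderivmZ -!mderivmU1m -!mderivmDm addmC.
Qed.

(** The functional f |-> (f(D) G)(0) in degree j, where f(D) is f with partial derivatives for
    variables. *)
Definition apolar_vec (G : R) : 'cV[k]_#|{: hmon n j 0}| := \col_c (G^`M[col_mon c])@_0.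

Lemma col_formX (w : 'cV[k]_#|{: hmon n j 0}|) c : col_form w 'X_[col_mon c] = w c 0.
Proof.
rewrite /col_form mxE (bigD1 c) //= big1 ?addr0 => [|c' ne].
  by rewrite mxE mcoeffX eqxx mul1r.
by rewrite mxE mcoeffX (inj_eq (@col_mon_inj _ _)) eq_sym (negPf ne) mul0r.
Qed.

(** Multiplication by X_r on one side of the pairing is differentiation by X_r on the other, so the
    linear form of u acts as [dirderiv u]. *)
Lemma apolar_exp (G : R) (u : 'rV[k]_n) q h : (mdeg h + q)%N = j ->
  col_form (apolar_vec G) ('X_[h] * linear_form u ^+ q) = (iter q (dirderiv u) G^`M[h])@_0.
Proof.
elim: q h => [|q IH] h eh.
  rewrite mulr1; have [c <-] := @col_mon_onto n j h (etrans (esym (addn0 _)) eh).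
  by rewrite col_formX mxE.
rewrite iterSr exprS /linear_form mulr_suml mulr_sumr raddf_sum /dirderiv.
have iterD : forall H : 'I_n -> R,
    iter q (dirderiv u) (\sum_r H r) = \sum_r iter q (dirderiv u) (H r).
  by move=> H; elim: (q) => //= q' ->; rewrite raddf_sum.
have iterZ : forall c H, iter q (dirderiv u) (c *: H) = c *: iter q (dirderiv u) H.
  by move=> c H; elim: (q) => //= q' ->; rewrite linearZ.
rewrite iterD raddf_sum; apply: eq_bigr => r _ /=.
rewrite iterZ mcoeffZ -mderivmU1m -mderivmDm -IH; last by rewrite mdegD mdeg1 -addnA.
rewrite -scalerAl -scalerAr mpolyXD -mulrA; exact: linearZ.
Qed.

(** [apolar_vec G] is a kernel vector, hence zero if the rank is full. Its entries are the
    coefficients of G times products of factorials, which are nonzero in characteristic zero. *)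
Lemma macaulay_not_full (L : 'M[k]_(m, n)) (G : R) :
    G != 0 -> G \is j.-homog -> (forall i, iter d (dirderiv (row i L)) G = 0) ->
  ~~ row_full (macaulay d j (fun i => linear_form (row i L) ^+ d)).
Proof.
move=> nz hG kill; apply: contraNN nz => full.
have Mw : macaulay d j (fun i => linear_form (row i L) ^+ d) *m apolar_vec G = 0.
  apply/colP => r; rewrite [RHS]mxE; set i := (enum_val r).1; set v := (enum_val r).2.
  transitivity (col_form (apolar_vec G) ('X_[mon_of v] * linear_form (row i L) ^+ d)).
    by rewrite /col_form !mxE; apply: eq_bigr => c _; rewrite !mxE.
  by rewrite apolar_exp ?mdeg_mon_of // -mderivm_dirderiv kill raddf0 mcoeff0.
have w0 : apolar_vec G = 0.
  have /row_fullP[B BM] := full.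
  by rewrite -[LHS]mul1mx -BM -mulmxA Mw mulmx0.
apply/eqP/mpolyP => h; rewrite mcoeff0.
have [/col_mon_onto[c <-]|ne] := eqVneq (mdeg h) j; last exact: dhomog_nemf_coeff hG ne.
have := congr1 (fun w : 'cV_ _ => w c 0) w0; rewrite !mxE mcoeff_mderivm addm0 => /eqP.
rewrite -mulr_natr mulf_eq0 => /orP[/eqP //|]; rewrite (pcharf0P k).1 //.
by rewrite eqn0Ngt prodn_gt0 // => i; rewrite ffactnn fact_gt0.
Qed.

End Apolarity.

(** * The left kernel of the coefficient matrix *)

Section Kernel.
Variables (k : fieldType) (hk : [pchar k] =i pred0) (n : nat) (L : 'M[k]_(n.+2, n)).
Hypothesis minors : forall f : 'I_n -> 'I_n.+2, injective f -> rowsub f L \in unitmx.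

(** What remains of c is a relation among n rows of L, and these are independent. *)
Lemma kernel_two_zeros (c : 'rV[k]_n.+2) i i' :
  i != i' -> c *m L = 0 -> c 0 i = 0 -> c 0 i' = 0 -> c = 0.
Proof.
move=> ne cL ci ci'; have [l el] : exists l, i' = lift i l.
  by case: (unliftP i i') => [l|] el; [exists l | rewrite el eqxx in ne].
pose f := fun t => lift i (lift l t).
have injf : injective f by move=> t t' /lift_inj /lift_inj.
have split (F : 'I_n.+2 -> k) : F i = 0 -> F i' = 0 -> \sum_t F t = \sum_t F (f t).
  move=> Fi Fi'; rewrite (bigD1_ord i) //= Fi add0r (bigD1_ord l) //= -el Fi' add0r.
  by [].
have cf : colsub f c *m rowsub f L = 0.
  apply/rowP => s; have := congr1 (fun v : 'rV_ _ => v 0 s) cL.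
  rewrite !mxE split ?ci ?ci' ?mul0r // => cs; apply: etrans cs.
  by apply: eq_bigr => t _; rewrite !mxE.
have {}cf : colsub f c = 0.
  by rewrite -[LHS](mulmxK (minors injf)) cf mul0mx.
apply/rowP => t; rewrite mxE; case: (unliftP i t) => [t' ->|->] //.
case: (unliftP l t') => [t'' ->|->]; last by rewrite -el.
by have := congr1 (fun v : 'rV_ _ => v 0 t'') cf; rewrite !mxE.
Qed.

Lemma rank_minors : \rank L = n.
Proof.
apply/eqP; rewrite eqn_leq rank_leq_col /=.
have inj2 : injective (fun t : 'I_n => lift ord0 (lift ord0 t)).
  by move=> t t' /lift_inj /lift_inj.
have := minors inj2; rewrite -row_full_unit -col_leq_rank => /leq_trans; apply.
exact/mxrankS/rowsub_sub.
Qed.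

(** The kernel is a plane; by [kernel_two_zeros] the columns of a basis A are distinct points of the
    projective line. A suitable t moves them all off infinity: u_i is the denominator and a_i the
    affine coordinate. *)
Lemma kernel_param : exists u a : 'I_n.+2 -> k,
  [/\ forall i, u i != 0, injective a &
      forall c : 'rV[k]_n.+2, c *m L = 0 ->
        exists s r, forall i, c 0 i = u i * (s + r * a i)].
Proof.
have rkK : \rank (kermx L) = 2%N by rewrite mxrank_ker rank_minors -addn2 addKn.
move: (row_base _) (eq_row_base (kermx L)); rewrite rkK => A eA.
have freeA : row_free A by rewrite -row_leq_rank eA rkK.
pose x s r : 'rV[k]_2 := \row_l (if l == 0 then s else r).
have xA s r i : (x s r *m A) 0 i = s * A 0 i + r * A 1 i.
  by rewrite mxE big_ord_recl big_ord1 (_ : lift ord0 ord0 = 1) ?mxE //; apply/val_inj.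
have AL s r : x s r *m A *m L = 0 by apply/sub_kermxP; rewrite -eA submxMl.
have indep i i' s r : i != i' -> s * A 0 i + r * A 1 i = 0 ->
    s * A 0 i' + r * A 1 i' = 0 -> s = 0 /\ r = 0.
  rewrite -!xA => ne e e'; have := kernel_two_zeros ne (AL s r) e e'.
  rewrite -(mul0mx _ A) => /(row_free_inj freeA) x0.
  have := congr1 (fun v : 'rV_ _ => v 0 1) x0; have := congr1 (fun v : 'rV_ _ => v 0 0) x0.
  by rewrite !mxE.
have nzcol i : ('X * (A 1 i)%:P + (A 0 i)%:P : {poly k}) != 0.
  apply/eqP => e0.
  have A0 : A 0 i = 0.
    by have := congr1 (fun p : {poly k} => p`_0%N) e0; rewrite coefD coefXM !coefC /= add0r.
  have A1 : A 1 i = 0.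
    by have := congr1 (fun p : {poly k} => p`_1%N) e0; rewrite coefD coefXM !coefC /= addr0.
  have [i' ne] : exists i', i != i' by exists (lift i 0); apply: neq_lift.
  (* These coefficients give a combination vanishing at i', and if column i is zero every
     combination vanishes at i. So column i' is zero too, and then the first basis row vanishes at
     both. *)
  have [h1 h2] := indep i i' (A 1 i') (- A 0 i') ne (ltac:(by rewrite A0 A1 !mulr0 addr0))
    (ltac:(by rewrite mulNr mulrC subrr)).
  have [/eqP] := indep i i' 1 0 ne (ltac:(by rewrite A0 A1 !mulr0 addr0))
    (ltac:(by rewrite h1; move/eqP: h2; rewrite oppr_eq0 => /eqP ->; rewrite !mulr0 addr0)).
  by rewrite oner_eq0.
have [t _] : exists2 t, t \notin [::] &
    (\prod_i ('X * (A 1 i)%:P + (A 0 i)%:P)).[t] != 0 :> k.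
  by apply: horner_neq0_avoid => //; apply/prodf_neq0 => i _.
rewrite horner_prod => /prodf_neq0 nzt.
pose u i := A 0 i + t * A 1 i; pose a i := A 1 i / u i.
have u0 i : u i != 0 by have := nzt i isT; rewrite !hornerE addrC.
have ua i : u i * a i = A 1 i by rewrite mulrC divfK.
exists u, a; split=> // [i i' e|c /sub_kermxP].
  apply/eqP/negPn/negP => ne.
  (* The combination A_1 - a_i (A_0 + t A_1) of the basis rows vanishes wherever a_l = a_i, so at
     both i and i'. *)
  have z l : a l = a i -> - a i * A 0 l + (1 - t * a i) * A 1 l = 0.
    move=> el; transitivity (A 1 l - a i * u l); first by rewrite /u; ring.
    by rewrite -el mulrC ua subrr.
  have [h1 h2] := indep i i' _ _ ne (z i erefl) (z i' (esym e)).
  move/eqP: h1; rewrite oppr_eq0 => /eqP h1; move/eqP: h2.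
  by rewrite h1 mulr0 subr0 oner_eq0.
rewrite -eA => /submxP[D ->]; exists (D 0 0), (D 0 1 - t * D 0 0) => i.
rewrite mulrDr mulrCA ua /u mxE big_ord_recl big_ord1.
rewrite (_ : lift ord0 ord0 = 1); last exact/val_inj.
by ring.
Qed.

End Kernel.

(** * Construction of the annihilated form *)

Definition cover (N T : nat) (i : 'I_N) : nat := (\sum_(p < T) (p %% N == i))%N.

Lemma cover_le N T delta (i : 'I_N) : (T <= N * delta)%N -> (cover T i <= delta)%N.
Proof.
have coverE T1 : cover T1 i = (\sum_(0 <= p < T1) (p %% N == i))%N by rewrite big_mkord.
rewrite !coverE => le; apply: (@leq_trans (\sum_(0 <= p < N * delta) (p %% N == i))%N).
  by rewrite [X in (_ <= X)%N](big_cat_nat (leq0n _) le) /= leq_addr.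
elim: delta {T le} => [|delta IH]; first by rewrite muln0 big_geq.
rewrite mulnS addnC (big_cat_nat (leq0n _) (leq_addr _ _)) /= -[X in (_ <= X)%N]addn1.
apply: leq_add => //; rewrite -{1}[(N * delta)%N]add0n big_addn addKn big_mkord.
have modE (p : 'I_N) : ((p + N * delta) %% N)%N = p.
  by rewrite addnC mulnC modnMDl modn_small.
rewrite (bigD1 i) //= big1 => [|p ne]; first by rewrite modE eqxx.
by rewrite modE [_ == _](negPf ne).
Qed.

Section Witness.
Variables (k : fieldType) (hk : [pchar k] =i pred0) (n : nat).
Variables (L : 'M[k]_(n.+2, n)) (C : 'M[k]_(n, n.+2)) (u a : 'I_n.+2 -> k).
Hypothesis CL : C *m L = 1%:M.
Hypothesis u_neq0 : forall i, u i != 0.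
Hypothesis a_inj : injective a.
Hypothesis ker_span : forall c : 'rV[k]_n.+2, c *m L = 0 ->
  exists s r, forall i, c 0 i = u i * (s + r * a i).
Local Notation R := {mpoly k[n]}.

(** The map y |-> y L has the lift x |-> x C, so y L C and y have the same image and differ by a
    kernel vector. *)
Lemma section_span (y : 'rV[k]_n.+2) :
  exists s r, forall i, (y *m L *m C) 0 i = y 0 i + u i * (s + r * a i).
Proof.
have [|s [r e]] := @ker_span (y *m L *m C - y).
  by rewrite mulmxBl -[_ *m C *m L]mulmxA CL mulmx1 subrr.
exists s, r => i; rewrite -e.
have -> : (y *m L *m C - y) 0 i = (y *m L *m C) 0 i - y 0 i by rewrite !mxE.
by rewrite addrC subrK.
Qed.

(** Coordinate i of the lift x C, divided by u_i. Another lift would change these forms by s + r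
    a_i, which [det_pade_shift] absorbs. *)
Definition dual_form i : R := (u i)^-1 *: linear_form (row i C^T).

Definition pade_form e (f : 'I_(e.+1 + e) -> 'I_n.+2) : R :=
  \det (pade (fun t => (a (f t))%:MP) (fun t => dual_form (f t))).

Lemma pade_form_homog e (f : 'I_(e.+1 + e) -> 'I_n.+2) : pade_form f \is e.-homog.
Proof.
have := @det_homog_cols k n _ (pade (fun t => (a (f t))%:MP) (fun t => dual_form (f t)))
  (fun c => if split c is inl _ then 0 else 1)%N.
rewrite big_split_ord /= (eq_bigr (fun=> 0%N)) => [|c _]; last by rewrite (unsplitK (inl c)).
rewrite big1_eq add0n (eq_bigr (fun=> 1%N)) => [|c _]; last by rewrite (unsplitK (inr c)).
rewrite sum1_card card_ord; apply=> t c; rewrite mxE; case: splitP => c' _.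
  by rewrite mxE -(rmorphXn (@mpolyC n k)) /= -[_%:MP]mulr1 mul_mpolyC dhomogZ // dhomog1.
rewrite mxE -(rmorphXn (@mpolyC n k)) /= mulrC mul_mpolyC; do 2!apply: dhomogZ.
exact: linear_form_homog.
Qed.

(** At the image of the point with coordinates u_i a_i^(e+1), the dual forms equal a_i^(e+1) up to a
    shift s + r a_i, which leaves a Vandermonde determinant. *)
Lemma pade_form_neq0 e (f : 'I_(e.+1 + e) -> 'I_n.+2) : injective f -> pade_form f != 0.
Proof.
move=> injf; pose y : 'rV[k]_n.+2 := \row_i (u i * a i ^+ e.+1).
have [s [r hsr]] := section_span y.
have ev i : (dual_form i).@[(y *m L) 0] = a i ^+ e.+1 + (s + r * a i).
  have -> : (dual_form i).@[(y *m L) 0] = (u i)^-1 * (y *m L *m C) 0 i.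
    rewrite mevalZ; congr (_ * _); rewrite /linear_form rmorph_sum mxE.
    by apply: eq_bigr => j _ /=; rewrite mevalZ mevalXU !mxE mulrC.
  by rewrite hsr mxE mulrDr !mulKf.
have nz := det_pade_neq0 (inj_comp a_inj injf).
apply: contra_neq nz => /(congr1 (meval ((y *m L) 0))).
rewrite meval0 /pade_form -det_map_mx map_pade => <-.
rewrite -[LHS](det_pade_shift _ _ s r); congr (\det _).
by apply: eq_pade => t /=; rewrite ?mevalC // ev.
Qed.

(** L_i is the image of the i-th unit vector. Up to a shift that the determinant ignores, moving
    along it changes only the rows t with f t = i, each linearly. *)
Lemma size_shift_pade_form e (f : 'I_(e.+1 + e) -> 'I_n.+2) i :
  (size (shift (row i L) (pade_form f)) <= (\sum_t (f t == i)).+1)%N.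
Proof.
have [s [r hsr]] := section_span (delta_mx 0 i).
pose z' t : {poly R} := (dual_form (f t))%:P +
  ((((f t == i)%:R / u (f t))%:MP)%:P * 'X).
have -> : shift (row i L) (pade_form f) = \det (pade (fun t => ((a (f t))%:MP)%:P) z').
  rewrite /pade_form -det_map_mx map_pade.
  rewrite -[RHS](det_pade_shift _ _ ((s%:MP)%:P * 'X) ((r%:MP)%:P * 'X)); congr (\det _).
  apply: eq_pade => t /=; first by rewrite shiftC.
  rewrite shiftZ shift_linear_form /z' /dual_form -mul_mpolyC polyCM mulrDr -addrA.
  congr (_ + _); rewrite mulrA -!polyCM -(rmorphM (@mpolyC n k)) /=.
  have -> : \sum_(j < n) row i L 0 j * row (f t) C^T 0 j =
      (f t == i)%:R + u (f t) * (s + r * a (f t)).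
    transitivity (((delta_mx 0 i : 'rV_n.+2) *m L *m C) 0 (f t)); last by rewrite hsr mxE eqxx.
    by rewrite -rowE mxE; apply: eq_bigr => j _; rewrite !mxE.
  rewrite mulrDr mulKf // [_^-1 * _]mulrC !rmorphD !rmorphM /=; ring.
apply: size_det_rows => t c; rewrite mxE; case: splitP => c' _; rewrite mxE -!polyC_exp.
  by apply: leq_trans (size_polyC_leq1 _) _.
rewrite mulrC mul_polyC; apply: leq_trans (size_scale_leq _ _) _.
apply: leq_trans (size_polyD _ _) _; rewrite geq_max.
rewrite (leq_trans (size_polyC_leq1 _)) //=.
case: (f t == i); last by rewrite mul0r mpolyC0 polyC0 mul0r size_poly0.
rewrite mul_polyC; apply: leq_trans (size_scale_leq _ _) _.
by rewrite size_polyX.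
Qed.

(* The 2e+1 points of each factor are consecutive modulo n+2, so that the
   concatenation of all the factors covers every point evenly. *)
Lemma exists_pade_product (es : seq nat) : all (fun e => e.*2 < n.+2)%N es ->
  exists G : R, [/\ G != 0, G \is (sumn es).-homog &
    forall i, (size (shift (row i L) G) <= (cover ((sumn es).*2 + size es) i).+1)%N].
Proof.
elim: es => [|e es IH] /=.
  exists 1; split; rewrite ?oner_eq0 ?dhomog1 // => i.
  by rewrite rmorph1 size_poly1.
move=> /andP[lte /IH[G [nzG homG szG]]]; set T := ((sumn es).*2 + size es)%N in szG.
pose f (t : 'I_(e.+1 + e)) : 'I_n.+2 := Ordinal (ltn_pmod (T + t) (ltn0Sn n.+1)).
have injf : injective f.
  move=> t t' /(congr1 val) /eqP; rewrite /= eqn_modDl !modn_small.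
  - by move=> /eqP /val_inj.
  - by apply: leq_trans (ltn_ord t') _; lia.
  - by apply: leq_trans (ltn_ord t) _; lia.
exists (pade_form f * G); split=> [||i].
- by rewrite mulf_neq0 // pade_form_neq0.
- by rewrite dhomogM // pade_form_homog.
rewrite rmorphM; apply: leq_trans (size_polyMleq _ _) _.
have -> : ((e + sumn es).*2 + (size es).+1 = T + (e.+1 + e))%N by rewrite /T; lia.
have -> : cover (T + (e.+1 + e)) i = (cover T i + \sum_t (f t == i))%N.
  by rewrite /cover big_split_ord.
have := leq_add (size_shift_pade_form f i) (szG i).
by rewrite addSn addnS [(cover _ _ + _)%N]addnC; case: (_ + _)%N.
Qed.

Lemma exists_witness K s delta : (K.*2 < n.+2)%N -> (K.*2.+1 * s <= K * (n.+2 * delta))%N ->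
  exists G : R, [/\ G != 0, G \is s.-homog &
    forall i, iter delta.+1 (dirderiv (row i L)) G = 0].
Proof.
move=> ltK le; have [K0|K0] := posnP K.
  have s0 : s = 0%N by move: le; rewrite K0; lia.
  exists 1; rewrite s0 dhomog1 oner_eq0; split=> // i.
  by apply: iter_dirderiv_eq0; rewrite rmorph1 size_poly1.
(* Cutting s into as few parts of size at most K as possible takes 2s + ceil(s/K) indices; the
   hypothesis says s/K <= (n+2) delta - 2s, an integer, so they fit. *)
pose es := nseq (s %/ K) K ++ (if (s %% K == 0)%N then [::] else [:: (s %% K)%N]).
have sum_es : sumn es = s.
  rewrite sumn_cat sumn_nseq mulnC [RHS](divn_eq s K); congr (_ + _)%N.
  by case: eqP => [->|] //=; rewrite addn0.
have size_es : ((sumn es).*2 + size es <= n.+2 * delta)%N.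
  rewrite sum_es size_cat size_nseq.
  have := divn_eq s K; have := ltn_pmod s K0; case: eqP => [->|] /=; nia.
have [|G [nzG homG szG]] := @exists_pade_product es.
  rewrite all_cat all_nseq ltK orbT /=; case: eqP => //= _; rewrite andbT.
  by apply: leq_ltn_trans ltK; rewrite leq_double ltnW // ltn_pmod.
exists G; rewrite -sum_es; split=> // i; apply: iter_dirderiv_eq0.
by apply: leq_trans (szG i) _; rewrite ltnS cover_le.
Qed.

End Witness.

(** * General forms *)

(** With K = [n.+1./2], the denominator 2K + 1 is n + 2 for odd n, where it cancels, and n + 1 for
    even n. *)
Lemma sdegE n d : (0 < d)%N ->
  sdeg n d = ((n.+1./2 * (n.+2 * d.-1)) %/ (n.+1./2).*2.+1)%N.
Proof.
move=> d0; rewrite /sdeg subn1; have := odd_double_half n.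
case: ifP => _ e; rewrite ?add1n ?add0n in e.
  have -> : n.+1./2 = (n./2).+1 by lia.
  move: (n./2) e => h <-; have -> : (h.*2.+2 * d.-1 = h.+1 * d.-1 * 2)%N by lia.
  have -> : (h.+1 * (h.*2.+3 * d.-1) = h.+1 * d.-1 * (h.+1).*2.+1)%N by nia.
  by rewrite !mulnK.
have -> : n.+1./2 = n./2 by lia.
move: (n./2) e => h <-.
have -> : (h.*2 * h.*2.+2 * d.-1 = 2 * (h * (h.*2.+2 * d.-1)))%N by nia.
by rewrite divnMl.
Qed.

Section General.
Variables (k : fieldType) (hk : [pchar k] =i pred0) (n d : nat).
Hypotheses (n_gt0 : (0 < n)%N) (d_gt0 : (0 < d)%N).

Definition vandermonde_forms : 'M[k]_(n.+2, n) := \matrix_(i, r) i%:R ^+ r.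

Lemma exp_linear_form_homog (v : 'rV[k]_n) : linear_form v ^+ d \is d.-homog.
Proof. by have := dhomogMn d (linear_form_homog v); rewrite mul1n. Qed.

Lemma ord_natr_inj m : injective (fun i : 'I_m => i%:R : k).
Proof. by move=> i j /natr_inj_pchar0 - /(_ hk) /val_inj. Qed.

Lemma vandermonde_minors : (maximal_minors k n.+2 n).@[mxvec vandermonde_forms 0] != 0.
Proof.
apply/maximal_minorsP => f injf.
have -> : rowsub f vandermonde_forms = (Vandermonde n (\row_t ((f t)%:R : k)))^T.
  by apply/matrixP => t c; rewrite !mxE.
rewrite unitmx_tr unitmxE unitfE det_Vandermonde.
apply/prodf_neq0 => i _; apply/prodf_neq0 => j ij.
by rewrite !mxE subr_eq0; apply: contraTneq ij => /ord_natr_inj /injf ->; rewrite ltnn.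
Qed.

(** Otherwise a nonzero column of [cokermx] is a functional in degree s(n, d) + 1 that kills the
    ideal, against [degree_bound]. *)
Lemma vandermonde_full :
  row_full (macaulay d (sdeg n d).+1 (fun i => linear_form (row i vandermonde_forms) ^+ d)).
Proof.
set M := macaulay _ _ _; apply/negPn/negP => notfull.
have [s ws] : exists s, col s (cokermx M) != 0.
  apply/existsP; rewrite -negb_forall; apply: contra notfull => /forallP h.
  rewrite -sub1mx submxE mul1mx; apply/eqP/matrixP => c s.
  by have /eqP/colP/(_ c) := h s; rewrite !mxE.
set w := col s _ in ws; have Mw : M *m w = 0 by rewrite /w colE mulmxA mulmx_coker mul0mx.
have formE i : linear_form (row i vandermonde_forms) = mform n (i%:R : k).
  by congr linear_form; apply/rowP => r; rewrite !mxE.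
have kill (i : 'I_n.+2) f : col_form w (mform n (i%:R : k) ^+ d.-1.+1 * f) = 0.
  rewrite prednK // mulrC -formE.
  exact: (col_form_ideal (fun i => exp_linear_form_homog _) i f Mw).
have nz : exists f, col_form w f <> 0.
  have /existsP[c wc] : [exists c, w c 0 != 0].
    rewrite -negb_forall; apply: contra ws => /forallP h; apply/eqP/colP => c.
    by rewrite [RHS]mxE; apply/eqP.
  by exists 'X_[col_mon c]; rewrite col_formX; apply/eqP.
have hom e f : f \is e.-homog -> e != (sdeg n d).+1 -> col_form w f = 0.
  exact: col_form_homog.
have := degree_bound hk hom n_gt0 (@ord_natr_inj n.+2) kill nz.
by rewrite (sdegE n d_gt0) leqNgt [X in (_ < X)%N]mulnC ltn_ceil.
Qed.

(** A monomial of degree j + 1 is a variable times one of degree j. Hence one degree, and one open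
    condition, settles the upper bound. *)
Lemma macaulay_full_succ (m j : nat) (g : 'I_m -> {mpoly k[n]}) :
    (forall i, g i \is d.-homog) ->
  row_full (macaulay d j g) -> row_full (macaulay d j.+1 g).
Proof.
move=> g_homog /macaulay_fullP - /(_ g_homog) full.
apply/macaulay_fullP => // f hf; rewrite [f]mpolyE big_seq.
elim/big_ind: _ => [|_ _ [c ->] [c' ->]|v hv].
- by exists (fun=> 0); rewrite big1 // => i _; rewrite mul0r.
- exists (fun i => c i + c' i); rewrite -big_split; apply: eq_bigr => i _.
  by rewrite mulrDl.
have dv : mdeg v = j.+1 := dhomog_mf hf hv.
have [r r0] : exists r, (v r != 0)%N.
  apply/existsP; rewrite -negb_forall; apply: contra_eqN dv => /forallP v0.
  by rewrite mdegE big1 // => r _; apply/eqP.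
have ev : v = (U_(r) + (v - U_(r)))%MM by rewrite addmC submK // lep1mP.
have [|c e] := full 'X_[(v - U_(r))].
  by rewrite dhomogX /=; move: dv; rewrite {1}ev mdegD mdeg1; lia.
exists (fun i => f@_v *: 'X_r * c i); rewrite {2}ev mpolyXD e mulr_sumr scaler_sumr.
by apply: eq_bigr => i _; rewrite -!scalerAl mulrA.
Qed.

End General.

Theorem theorem3p4 (k : fieldType) (n d : nat) (hk : [pchar k] =i pred0)
    (hn : (1 <= n)%N) (hd : (1 <= d)%N) :
  for_general_forms (fun l : 'I_n.+2 -> {mpoly k[n]} =>
    exists h : nat -> nat,
      is_hilbert_series (fun i => l i ^+ d) h /\ is_series_degree h (sdeg n d)).
Proof.
have [q q0 full] := macaulay_full_open (vandermonde_full hk hn hd).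
(* The minors serve the lower bound and [q] the upper one; both are nonzero at the moment curve
   example, so the open set is nonempty. *)
pose p := maximal_minors k n.+2 n * q.
exists (fun x => p.@[x 0] <> 0); split.
- by exists (fun p' => p' = p) => x; split=> [|[_ ->]] //; exists p.
- exists (mxvec (vandermonde_forms k n)); apply/eqP.
  by rewrite mevalM mulf_neq0 // vandermonde_minors.
move=> L /eqP; rewrite mevalM mulf_eq0 negb_or => /andP[/maximal_minorsP minors /full fullL].
pose g i := linear_form (row i L) ^+ d.
have g_homog i : g i \is d.-homog by apply: exp_linear_form_homog.
exists (fun j => #|{: hmon n j 0}| - \rank (macaulay d j g))%N; split.
  by move=> j; apply: quotient_dim_macaulay.
have dim_eq0 j : (#|{: hmon n j 0}| - \rank (macaulay d j g) == 0)%N =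
    row_full (macaulay d j g).
  by rewrite subn_eq0 col_leq_rank.
split=> [|j].
  have /row_fullP[C CL] : row_full L by rewrite /row_full rank_minors.
  have [u [a [u0 inja span]]] := kernel_param hk minors.
  have [||G [nzG homG kill]] := @exists_witness k n L C u a CL u0 inja span
      n.+1./2 (sdeg n d) d.-1.
  - by have := odd_double_half n.+1; lia.
  - by rewrite sdegE // mulnC leq_trunc_div.
  apply/eqP; rewrite dim_eq0; apply: (macaulay_not_full hk nzG homG) => i.
  by rewrite -[d]prednK.
move/eqP; rewrite dim_eq0; apply: contraNleq => lt.
rewrite -(subnK lt); elim: (j - _)%N => [|t IH]; first exact: fullL.
exact: macaulay_full_succ.
Qed.
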